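(* Let $t,s\in\mathbb{Z}_{12}\setminus\{0\}$ with $t\neq s$ and $q:=t+s\not\equiv 0\pmod{12}$, and let $G(t,s)$ be the Levi graph of the 12-TET harmonic system with generator $q$ and thirds $(t,s)$. Then $G(t,s)$ is isomorphic to one of the following eight canonical Levi graphs (listed with a name and the signature of the canonical offset, alternative signatures occurring in the same class being separated by $\cong$): \begin{enumerate} \item (Wide Thirds) $L_{12}(0,1,2)$, signature $\{1,1,10\}$; \item (Far Narrow) $L_{12}(0,1,3)$, signature $\{1,2,9\}\cong\{2,3,7\}$; \item (Standard) $L_{12}(0,1,4)$, signature $\{1,3,8\}\cong\{3,4,5\}$; \item (Far Wide) $L_{12}(0,1,5)$, signature $\{1,4,7\}$; \item (Tritone) $L_{12}(0,1,6)$, signature $\{1,5,6\}$; \item (Tritone-Wide) $L_{12}(0,2,4)$, signature $\{2,2,8\}$; \item (Tritonian Fifth) $L_{12}(0,2,6)$, signature $\{2,4,6\}$; \item (Equally Spaced) $L_{12}(0,3,6)$, signature $\{3,3,6\}$. \end{enumerate}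
   Context: For a three-element subset (offset) $S\subset\mathbb{Z}_n$, the Levi graph $L_n(S)$ is the bipartite graph with vertices $P_0,\dots,P_{n-1}$ (points) and $L_0,\dots,L_{n-1}$ (lines), indices in $\mathbb{Z}_n$, and edges $P_i\sim L_{i+\sigma}$ for all $i\in\mathbb{Z}_n$, $\sigma\in S$; we write $L_n(a,b,c)=L_n(\{a,b,c\})$. An isomorphism of Levi graphs is a graph isomorphism which either maps points to points and lines to lines, or interchanges points and lines. A 12-TET harmonic system with generator (``fifth'') $q$ and thirds $(t,s)$, where $t+s\equiv q \pmod{12}$, has 12 Major chords $M_k=\{k,k+t,k+q\}$ and 12 minor chords $m_k=\{k,k+s,k+q\}$, $k\in\mathbb{Z}_{12}$, regarded as 24 distinct formal vertices. Its Levi graph $G(t,s)$ has these 24 vertices, and $M_k$ is adjacent to $m_k$, $m_{k+t}$ and $m_{k-s}$. Thus $G(t,s)=L_{12}(\{0,t,12-s\})$, with $M_k$ as point $P_k$ and $m_k$ as line $L_k$. The signature of an offset $\{a<b<c\}\subset\{0,\dots,11\}$ is the multiset of successive cyclic differences $\{b-a,\,c-b,\,12-c+a\}$; the alternative signatures are those of affinely equivalent offsets, i.e. offsets of the form $\{\alpha x+\beta : x\in S\}$ with $\alpha\in\mathbb{Z}_{12}^*$, $\beta\in\mathbb{Z}_{12}$. *)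

(* Defs.v *)
From mathcomp Require Import all_boot all_order all_algebra.

Set Implicit Arguments.
Unset Strict Implicit.
Unset Printing Implicit Defensive.

Import GRing.Theory.
Local Open Scope ring_scope.

(* [inl i] is the point P_i and [inr j] is the line L_j.  As 'Z_0 and 'Z_1 are
   both Z/2 in the library, this is only meaningful for [1 < n]. *)
Definition levi_vertex (n : nat) : finType := ('Z_n + 'Z_n)%type.

Definition is_point (n : nat) (v : levi_vertex n) : bool :=
  if v is inl _ then true else false.

Definition levi_graph (n : nat) (S : {set 'Z_n}) : rel (levi_vertex n) :=
  fun u v =>
    match u, v with
    | inl i, inr j | inr j, inl i => [exists x in S, j == i + x]
    | _, _ => false
    end.

(* [inl k] is the Major chord M_k = {k, k+t, k+q} and [inr k] is the minor chord
   m_k = {k, k+s, k+q}, where q = t + s; the 24 chords are formal vertices. *)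
Definition harmonic_levi_graph (t s : 'Z_12) : rel (levi_vertex 12) :=
  fun u v =>
    match u, v with
    | inl k, inr l | inr l, inl k => l \in [:: k; k + t; k - s]
    | _, _ => false
    end.

Definition levi_isomorphism (n : nat) (e1 e2 : rel (levi_vertex n))
    (f : levi_vertex n -> levi_vertex n) : Prop :=
  [/\ bijective f,
      forall u v, e2 (f u) (f v) = e1 u v
    & (forall v, is_point (f v) = is_point v) \/
      (forall v, is_point (f v) = ~~ is_point v)].

Definition levi_isomorphic (n : nat) (e1 e2 : rel (levi_vertex n)) : Prop :=
  exists f, levi_isomorphism e1 e2 f.

(* The differences are taken in nat, between representatives in {0, ..., 11};
   multisets are sequences up to [perm_eq]. *)
Definition has_signature (S : {set 'Z_12}) (w : seq nat) : Prop :=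
  exists a b c : 'Z_12,
    [/\ (a < b < c)%N, S = [set a; b; c]
      & perm_eq w [:: (b - a)%N; (c - b)%N; (12 - c + a)%N]].

Definition affinely_equivalent (S S' : {set 'Z_12}) : Prop :=
  exists alpha beta : 'Z_12,
    alpha \is a GRing.unit /\ S' = [set alpha * x + beta | x in S].

Inductive canonical_class : Type :=
  | WideThirds
  | FarNarrow
  | Standard
  | FarWide
  | Tritone
  | TritoneWide
  | TritonianFifth
  | EquallySpaced.

Definition canonical_offset (c : canonical_class) : {set 'Z_12} :=
  match c with
  | WideThirds     => [set 0; 1; 2]
  | FarNarrow      => [set 0; 1; 3]
  | Standard       => [set 0; 1; 4]
  | FarWide        => [set 0; 1; 5]
  | Tritone        => [set 0; 1; 6]
  | TritoneWide    => [set 0; 2; 4]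
  | TritonianFifth => [set 0; 2; 6]
  | EquallySpaced  => [set 0; 3; 6]
  end.

Definition canonical_signature (c : canonical_class) : seq nat :=
  match c with
  | WideThirds     => [:: 1; 1; 10]%N
  | FarNarrow      => [:: 1; 2; 9]%N
  | Standard       => [:: 1; 3; 8]%N
  | FarWide        => [:: 1; 4; 7]%N
  | Tritone        => [:: 1; 5; 6]%N
  | TritoneWide    => [:: 2; 2; 8]%N
  | TritonianFifth => [:: 2; 4; 6]%N
  | EquallySpaced  => [:: 3; 3; 6]%N
  end.

(* Not an exhaustive list: {0, 5, 10} is affinely equivalent to {0, 1, 2} and
   has signature {2, 5, 5}. *)
Definition listed_alternative_signatures (c : canonical_class) : seq (seq nat) :=
  match c with
  | FarNarrow => [:: [:: 2; 3; 7]%N]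
  | Standard  => [:: [:: 3; 4; 5]%N]
  | _         => [::]
  end.

(* Main.v *)
Require Import Defs.
From mathcomp Require Import all_boot all_order all_algebra.
Import GRing.Theory.
Local Open Scope ring_scope.

(** The graph [G(t,s)] is the Levi graph of the offset [{0, t, -s}]
    ([harmonic_levi_graphE]), and an affine bijection [x |-> alpha x + beta]
    between offsets lifts to an isomorphism of their Levi graphs
    ([affine_levi_isomorphic]).  It remains to bring [{0, t, -s}] to one of the
    eight canonical offsets by an affine map ([canonical_offset_exists]).

    Such a map exists for the following reason.  If two elements of the offset
    differ by a unit, a translation and a scaling send them to [0] and [1], so
    that the offset becomes [{0, 1, c}], and the reflection [x |-> 1 - x]
    exchanges [c] and [1 - c], so that [c] may be taken among [2, ..., 6].
    Otherwise every difference is divisible by [2] or by [3].  When all are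
    even, the offset is, up to an affine map, the double of a triple of residues
    modulo [6]: this gives [{0, 2, 4}], [{0, 2, 6}] and [{0, 4, 8}].
    When some difference is odd, two of the three cyclic differences are, these
    are [3] or [9] and their sum is not [0]: this gives [{0, 3, 6}].
    The offset [{0, 4, 8}] is the one that has no place in the list, and
    [{0, t, -s}] is equal to it exactly when [t = s = 4] or [t = s = 8], which
    [t != s] rules out.  As there are few pairs [(t, s)] and few affine maps,
    the lemma [canonical_search] finds the map by exhaustion instead. *)

(** As [alpha (i + x) + beta = alpha i + (alpha x + beta)], the map
    [P_i |-> P_(alpha i)], [L_j |-> L_(alpha j + beta)] sends edges to edges, and
    it reflects them because [alpha] is invertible.  Only the lines are
    translated: the same translation of the points would cancel [beta]. *)
Lemma affine_levi_isomorphic n (S : {set 'Z_n}) (alpha beta : 'Z_n) :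
  alpha \is a GRing.unit ->
  levi_isomorphic (levi_graph S)
    (levi_graph [set alpha * x + beta | x in S]).
Proof.
move=> Ua.
pose f (v : levi_vertex n) : levi_vertex n :=
  match v with inl i => inl (alpha * i) | inr j => inr (alpha * j + beta) end.
pose g (v : levi_vertex n) : levi_vertex n :=
  match v with
  | inl i => inl (alpha^-1 * i) | inr j => inr (alpha^-1 * (j - beta))
  end.
have edge (i j : 'Z_n) :
    [exists y in [set alpha * x + beta | x in S],
       alpha * j + beta == alpha * i + y] = [exists x in S, j == i + x].
  apply/exists_inP/exists_inP => [[_ /imsetP[x Sx ->] /eqP] | [x Sx /eqP->]].
    rewrite addrA -mulrDr => /addIr/(mulrI Ua) ->.
    by exists x.
  exists (alpha * x + beta); first exact: imset_f.
  by rewrite addrA -mulrDr.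
exists f; split.
- exists g => -[i|j] /=; rewrite ?addrK ?mulKr //.
    by rewrite mulVKr.
  by rewrite mulVKr // subrK.
- by move=> [i|j] [i'|j'] //=; rewrite edge.
- by left; case.
Qed.

Lemma harmonic_levi_graphE (t s : 'Z_12) :
  harmonic_levi_graph t s =2 levi_graph [set 0; t; - s].
Proof.
have edge (k l : 'Z_12) :
    (l \in [:: k; k + t; k - s]) = [exists x in [set 0; t; - s], l == k + x].
  rewrite !inE; apply/idP/exists_inP => [|[x]].
    by case/or3P=> /eqP->; [exists 0 | exists t | exists (- s)];
       rewrite ?inE ?addr0 ?eqxx ?orbT.
  by rewrite !inE => /orP[/orP[]|] /eqP-> /eqP->; rewrite ?addr0 eqxx ?orbT.
by move=> [k|l] [k'|l'] //=; rewrite edge.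
Qed.

Lemma eq_levi_isomorphic n (e1 e1' e2 : rel (levi_vertex n)) :
  e1 =2 e1' -> levi_isomorphic e1' e2 -> levi_isomorphic e1 e2.
Proof. by move=> e11' [f [bf ef sf]]; exists f; split=> // u v; rewrite e11'. Qed.

(** The search below runs by evaluation, whereas finite sets and enumerations of
    finite types do not evaluate; hence explicit lists in their place. *)
Definition residues12 : seq 'Z_12 := [seq inZp i | i <- iota 0 12].

Definition canonical_classes : seq canonical_class :=
  [:: WideThirds; FarNarrow; Standard; FarWide; Tritone; TritoneWide;
      TritonianFifth; EquallySpaced].

Definition canonical_triple (c : canonical_class) : seq 'Z_12 :=
  match c with
  | WideThirds     => [:: 0; 1; 2]
  | FarNarrow      => [:: 0; 1; 3]
  | Standard       => [:: 0; 1; 4]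
  | FarWide        => [:: 0; 1; 5]
  | Tritone        => [:: 0; 1; 6]
  | TritoneWide    => [:: 0; 2; 4]
  | TritonianFifth => [:: 0; 2; 6]
  | EquallySpaced  => [:: 0; 3; 6]
  end.

Lemma mem_residues12 (x : 'Z_12) : x \in residues12.
Proof.
by apply/mapP; exists (val x); rewrite ?mem_iota ?valZpK //= (ltn_ord x).
Qed.

Lemma mem_canonical_triple c : canonical_triple c =i canonical_offset c.
Proof. by case: c => x; rewrite !inE orbA. Qed.

Definition affine_to_canonical (t s alpha beta : 'Z_12) c : bool :=
  perm_eq [seq alpha * x + beta | x <- [:: 0; t; - s]] (canonical_triple c).

Lemma affine_to_canonicalP t s alpha beta c :
  affine_to_canonical t s alpha beta c ->
  canonical_offset c = [set alpha * x + beta | x in [set 0; t; - s]].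
Proof.
move=> /perm_mem eq_img; apply/setP => y.
rewrite -mem_canonical_triple -eq_img.
by apply/mapP/imsetP => -[x x_in ->]; exists x => //;
   move: x_in; rewrite !inE orbA.
Qed.

(** Some element of the offset goes to the element [0] of the canonical offset;
    this leaves three translations for each of the four units. *)
Lemma canonical_search :
  all (fun t => all (fun s =>
    [&& t != 0, s != 0, t != s & t + s != 0] ==>
    has (fun alpha =>
      has (fun beta => has (affine_to_canonical t s alpha beta)
        canonical_classes)
      [:: 0; - (alpha * t); alpha * s]) [:: 1; 5; 7; 11])
    residues12) residues12.
Proof.
(* Call by need, so that each [has] stops at its first success. *)
by lazy.
Qed.

Lemma canonical_offset_exists (t s : 'Z_12) :
  t != 0 -> s != 0 -> t != s -> t + s != 0 ->
  exists c, affinely_equivalent [set 0; t; - s] (canonical_offset c).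
Proof.
move=> ht hs hts hq.
have := allP (allP canonical_search t (mem_residues12 t)) s (mem_residues12 s).
rewrite ht hs hts hq => /hasP[alpha alphaP /hasP[beta _]].
move=> /(has_nthP WideThirds)[i _ /affine_to_canonicalP eq_c].
exists (nth WideThirds canonical_classes i), alpha, beta; split=> //.
by move: alphaP; rewrite !inE => /or4P[] /eqP->.
Qed.

Lemma canonical_offset_signature c :
  has_signature (canonical_offset c) (canonical_signature c).
Proof.
by case: c; [exists 0, 1, 2 | exists 0, 1, 3 | exists 0, 1, 4 | exists 0, 1, 5
  | exists 0, 1, 6 | exists 0, 2, 4 | exists 0, 2, 6 | exists 0, 3, 6].
Qed.

(** Multiplication by the unit [5] sends [{0, 1, 3}] to [{0, 3, 5}] and
    [{0, 1, 4}] to [{0, 5, 8}]. *)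
Lemma listed_alternative_signatureP c w :
  w \in listed_alternative_signatures c ->
  exists S, affinely_equivalent (canonical_offset c) S /\ has_signature S w.
Proof.
move=> w_alt; exists [set 5 * x + 0 | x in canonical_offset c].
split; first by exists 5, 0.
case: c w_alt => //=; rewrite inE => /eqP->; rewrite !imsetU !imset_set1.
  exists 0, 3, 5; split=> //.
  by apply/setP => x; rewrite !inE -!orbA; congr (_ || _); rewrite orbC.
exists 0, 5, 8; split=> //.
by apply/setP => x; rewrite !inE.
Qed.

Theorem theorem14 (t s : 'Z_12) (ht : t != 0) (hs : s != 0) (hts : t != s)
    (hq : t + s != 0) :
  (exists c : canonical_class,
     levi_isomorphic (harmonic_levi_graph t s) (levi_graph (canonical_offset c)))
  /\
  (forall c : canonical_class,
     has_signature (canonical_offset c) (canonical_signature c) /\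
     (forall w : seq nat, w \in listed_alternative_signatures c ->
        exists S : {set 'Z_12},
          affinely_equivalent (canonical_offset c) S /\ has_signature S w)).
Proof.
split=> [|c]; last first.
  by split=> [|w]; [exact: canonical_offset_signature
                   | exact: listed_alternative_signatureP].
have [c [alpha [beta [Ua eq_c]]]] := canonical_offset_exists t s ht hs hts hq.
exists c; apply: eq_levi_isomorphic (harmonic_levi_graphE t s) _.
rewrite eq_c; exact: affine_levi_isomorphic.
Qed.
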